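(* Let $X$ and $Y$ be real symmetric $n\times n$ matrices such that $X\succeq 0$ and $Y$ has zero diagonal. Let $A$ be the $(0,1)$-matrix whose support coincides with the support of $X\circ Y$ (so $A_{ij}=1$ if $X_{ij}Y_{ij}\neq 0$ and $A_{ij}=0$ otherwise), and let $G$ be the graph on $\{1,\dots,n\}$ with adjacency matrix $A$. Then $$\langle X,Y\rangle^2\ \le\ \left(1-\frac{1}{\chi_{\mathrm{vec}}(G)}\right)\langle X,X\rangle\,\langle Y,Y\rangle .$$
   Context: $\langle M,N\rangle=\mathrm{tr}(MN)$ on real symmetric matrices; $\circ$ is the entrywise product; $Z\ge 0$ means entrywise nonnegative; $Z\succeq 0$ means real symmetric positive semidefinite. For a finite simple graph $G$ whose complement has adjacency matrix $\overline{A}$, the vector chromatic number $\chi_{\mathrm{vec}}(G)$ is the maximum of $\langle J,Z\rangle$ ($J$ the all-ones matrix) over real symmetric $Z$ indexed by $V(G)$ with $\langle I,Z\rangle=1$, $Z\circ\overline{A}=0$, $Z\ge 0$, $Z\succeq 0$. *)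

(* Defs.v *)
From mathcomp Require Import all_boot all_order all_algebra.
From mathcomp Require Import lra.
From mathcomp Require Import all_classical all_reals all_analysis.

Set Implicit Arguments.
Unset Strict Implicit.
Unset Printing Implicit Defensive.

Import Order.TTheory GRing.Theory Num.Theory.
Import numFieldNormedType.Exports.

Local Open Scope classical_set_scope.
Local Open Scope ring_scope.

Record sgraph (V : finType) := SGraph {
  adj :> rel V;
  adj_sym : symmetric adj;
  adj_irrefl : irreflexive adj
}.

Definition compl_adj (V : finType) (G : sgraph V) : rel V :=
  fun x y => (x != y) && ~~ G x y.

Lemma compl_adj_sym (V : finType) (G : sgraph V) : symmetric (compl_adj G).
Proof. by move=> x y; rewrite /compl_adj eq_sym adj_sym. Qed.

Lemma compl_adj_irrefl (V : finType) (G : sgraph V) :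
  irreflexive (compl_adj G).
Proof. by move=> x; rewrite /compl_adj eqxx. Qed.

Definition compl_graph (V : finType) (G : sgraph V) : sgraph V :=
  SGraph (compl_adj_sym G) (compl_adj_irrefl G).

Definition adjmx (R : realType) (n : nat) (G : sgraph 'I_n) : 'M[R]_n :=
  \matrix_(i, j) (G i j)%:R.

Definition mxdot (R : realType) (n : nat) (M N : 'M[R]_n) : R := \tr (M *m N).

Definition mxhad (R : realType) (n : nat) (M N : 'M[R]_n) : 'M[R]_n :=
  map2_mx *%R M N.

Definition psdmx (R : realType) (n : nat) (M : 'M[R]_n) : Prop :=
  M^T = M /\ forall v : 'cV[R]_n, 0 <= (v^T *m M *m v) 0 0.

Definition chi_vec_feasible (R : realType) (n : nat) (G : sgraph 'I_n)
    (Z : 'M[R]_n) : Prop :=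
  [/\ mxdot 1%:M Z = 1,
      mxhad Z (adjmx R (compl_graph G)) = 0,
      forall i j, 0 <= Z i j
    & psdmx Z].

(* The supremum is a maximum as soon as there is a vertex: see [chi_vec_max].
   Without vertices nothing is feasible and [chi_vec R G = sup set0 = 0]. *)
Definition chi_vec (R : realType) (n : nat) (G : sgraph 'I_n) : R :=
  sup [set mxdot (const_mx 1) Z | Z in chi_vec_feasible (R := R) G].

Lemma chi_vec_feasible_le1 (R : realType) (n : nat) (G : sgraph 'I_n)
    (Z : 'M[R]_n) (i j : 'I_n) :
  chi_vec_feasible G Z -> Z i j <= 1.
Proof.
move=> [tr1 _ Z0 [Zsym Zpsd]].
have dle k : Z k k <= 1.
  by rewrite -tr1 /mxdot mul1mx /mxtrace (bigD1 k)//= lerDl sumr_ge0.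
have := Zpsd (delta_mx i 0 - delta_mx j 0).
rewrite [(_ - _)^T]raddfB /= !trmx_delta mulmxBl mulmxBr !mulmxBl -!rowE.
rewrite -!colE !mxE.
have -> : Z j i = Z i j by rewrite -[in LHS]Zsym mxE.
have := dle i; have := dle j; lra.
Qed.

Lemma continuous_sumr (R : realType) (T : topologicalType) (I : finType)
    (f : I -> T -> R) :
  (forall i, continuous (f i)) -> continuous (fun x => \sum_i f i x).
Proof.
move=> fc x; apply: cvg_big => [|i _]; last exact: fc.
exact: add_continuous.
Qed.

Lemma chi_vec_feasible_compact (R : realType) (n : nat) (G : sgraph 'I_n) :
  compact [set v : 'rV[R]_(n * n) | chi_vec_feasible G (vec_mx v)].
Proof.
have coordc i j : continuous (fun v : 'rV[R]_(n * n) => vec_mx v i j).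
  have -> : (fun v : 'rV[R]_(n * n) => vec_mx v i j) =
      (fun v => v 0 (mxvec_index i j)) by apply/funext => v; rewrite mxE.
  exact: coord_continuous.
have trc : continuous (fun v : 'rV[R]_(n * n) => \tr (vec_mx v)).
  by apply: continuous_sumr => i; exact: coordc.
have quadc (w : 'cV[R]_n) :
    continuous (fun v : 'rV[R]_(n * n) => (w^T *m vec_mx v *m w) 0 0).
  have -> : (fun v : 'rV[R]_(n * n) => (w^T *m vec_mx v *m w) 0 0) =
      (fun v => \sum_j (\sum_i w i 0 * vec_mx v i j) * w j 0).
    apply/funext => v; rewrite mxE; apply: eq_bigr => j _; congr (_ * _).
    by rewrite mxE; apply: eq_bigr => i _; rewrite mxE.
  apply: continuous_sumr => j v; apply: continuousM; last exact: cst_continuous.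
  apply: continuous_sumr => i {}v; apply: continuousM.
    exact: cst_continuous.
  exact: coordc.
have closed_pre (f : 'rV[R]_(n * n) -> R) (A : set R) :
    continuous f -> closed A -> closed (f @^-1` A).
  by move=> /continuous_closedP; exact.
apply: bounded_closed_compact.
  exists 1; split => // M M1 v /= vF.
  rewrite [leLHS]mx_normrE; apply/bigmax_leP; split=> [|[i k] _ /=].
    by rewrite ltW// (lt_trans _ M1).
  rewrite ord1; case/mxvec_indexP: k => p q.
  have -> : v 0 (mxvec_index p q) = vec_mx v p q by rewrite mxE.
  have [_ _ v0 _] := vF.
  by rewrite ger0_norm// (le_trans (chi_vec_feasible_le1 _ _ vF))// ltW.
have -> : [set v : 'rV[R]_(n * n) | chi_vec_feasible G (vec_mx v)] =
    [set v : 'rV[R]_(n * n) | \tr (vec_mx v) = 1] `&`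
    \bigcap_(i in setT) \bigcap_(j in setT)
      ([set v | vec_mx v i j * adjmx R (compl_graph G) i j = 0] `&`
       [set v | 0 <= vec_mx v i j] `&`
       [set v | vec_mx v i j - vec_mx v j i = 0]) `&`
    \bigcap_(w in [set: 'cV[R]_n]) [set v : 'rV[R]_(n * n) | 0 <= (w^T *m vec_mx v *m w) 0 0].
  apply/seteqP; split=> v /=.
    rewrite /chi_vec_feasible /mxdot mul1mx => -[tr1 had Z0 [sym psd]].
    split; last by move=> w _; exact: psd.
    split=> // i _ j _; split; first split=> //=.
      by move/matrixP: had => /(_ i j); rewrite !mxE.
    by rewrite /= -[in X in X - _]sym mxE subrr.
  move=> [[tr1 H] psd]; split.
  - by rewrite /mxdot mul1mx.
  - by apply/matrixP => i j; have [[/= + _] _] := H i I j I; rewrite !mxE.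
  - by move=> i j; have [[_ /=]] := H i I j I.
  - split; last by move=> w; exact: psd.
    by apply/matrixP => i j; have [_ /= /subr0_eq E] := H j I i I; rewrite [LHS]mxE.
apply: closedI; first apply: closedI.
- by apply: (closed_pre _ [set x | x = 1]) => //; exact: closed_eq.
- apply: closed_bigI => i _; apply: closed_bigI => j _.
  apply: closedI; first apply: closedI.
  + apply: (closed_pre _ [set x | x = 0]); last exact: closed_eq.
    by move=> v; apply: continuousM; [exact: coordc|exact: cst_continuous].
  + by apply: (closed_pre _ [set x | 0 <= x]) => //; exact: closed_ge.
  + apply: (closed_pre _ [set x | x = 0]); last exact: closed_eq.
    by move=> v; apply: continuousB; exact: coordc.
- apply: closed_bigI => w _.
  by apply: (closed_pre _ [set x | 0 <= x]) => //; exact: closed_ge.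
Qed.

Lemma chi_vec_max (R : realType) (n : nat) (G : sgraph 'I_n) :
  (0 < n)%N ->
  exists Z : 'M[R]_n,
    [/\ chi_vec_feasible G Z, chi_vec R G = mxdot (const_mx 1) Z
      & forall W, chi_vec_feasible G W ->
          mxdot (const_mx 1) W <= mxdot (const_mx 1) Z].
Proof.
move=> n0; pose F := [set v : 'rV[R]_(n * n) | chi_vec_feasible G (vec_mx v)].
have F0 : F !=set0.
  pose k := Ordinal n0; exists (mxvec (delta_mx k k)).
  rewrite /F /= mxvecK; split.
  - rewrite /mxdot mul1mx /mxtrace (bigD1 k)//= mxE !eqxx big1 ?addr0//.
    by move=> i /negbTE ik; rewrite mxE ik.
  - apply/matrixP => i j; rewrite !mxE /= /compl_adj.
    by case: (eqVneq i k) => [->|]; case: (eqVneq j k) => [->|];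
      rewrite ?eqxx ?mulr0 ?mul0r.
  - by move=> i j; rewrite mxE.
  - split=> [|w]; first by rewrite trmx_delta.
    rewrite -(mul_delta_mx (0 : 'I_1)) mulmxA -mulmxA -rowE -colE mxE big_ord1.
    by rewrite !mxE -expr2 sqr_ge0.
have objc : continuous (fun v : 'rV[R]_(n * n) => mxdot (const_mx 1) (vec_mx v)).
  have -> : (fun v : 'rV[R]_(n * n) => mxdot (const_mx 1) (vec_mx v)) =
      (fun v => \sum_i \sum_j v 0 (mxvec_index j i)).
    apply/funext => v; apply: eq_bigr => i _; rewrite mxE.
    by apply: eq_bigr => j _; rewrite !mxE mul1r.
  by do 2![apply: continuous_sumr => ?]; exact: coord_continuous.
have [v /set_mem vF vmax] := EVT_max_rV F0 (chi_vec_feasible_compact (G := G))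
  (continuous_subspaceT objc).
have ub W : chi_vec_feasible G W ->
    mxdot (const_mx 1) W <= mxdot (const_mx 1) (vec_mx v).
  by rewrite -[W]mxvecK => WF; apply: vmax; rewrite inE.
exists (vec_mx v); split => //; apply/eqP; rewrite eq_le; apply/andP; split.
  apply: ge_sup => [|_ [W WF <-]]; last exact: ub.
  by exists (mxdot (const_mx 1) (vec_mx v)), (vec_mx v).
apply: ub_le_sup; last by exists (vec_mx v).
by exists (mxdot (const_mx 1) (vec_mx v)) => _ [W WF <-]; exact: ub.
Qed.

(* Main.v *)
(* By Cauchy-Schwarz on the edges it suffices that W = X o X satisfies
   <A, W> <= (1 - 1/t) <J, W> with t = chi_vec G.  Strong duality gives M psd
   with diagonal entries at most t - 1 and entries at most -1 on the edges,
   hence with all entries at most t - 1; the claim is 0 <= <M, W>, which holds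
   by the Schur product theorem.
   Duality is obtained by minimising over psd M the sum of the squared excesses
   of M over these bounds.  If the minimum is positive, the matrix Z of excesses
   at a minimiser is, by first-order optimality, psd with <Z, M> <= 0, and
   rescaling Z to trace 1 gives a feasible point of value greater than t. *)
Require Import Defs.
From mathcomp Require Import all_boot all_order all_algebra.
From mathcomp Require Import ring lra.
From mathcomp Require Import all_classical all_reals all_analysis.

Set Implicit Arguments.
Unset Strict Implicit.

Import Order.TTheory GRing.Theory Num.Theory.
Import numFieldNormedType.Exports.
Local Open Scope ring_scope.

(** * Trace products and quadratic forms as sums; Cauchy-Schwarz *)

Lemma mxdot_sum (R : realType) (n : nat) (M N : 'M[R]_n) :
  mxdot M N = \sum_i \sum_j M i j * N j i.
Proof. by apply: eq_bigr => i _; rewrite mxE. Qed.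

Lemma sum_cauchy_schwarz (R : realType) (I : finType) (a b : I -> R) :
  (\sum_i a i * b i) ^+ 2 <= (\sum_i a i ^+ 2) * (\sum_i b i ^+ 2).
Proof.
set C := \sum_i _; set B := \sum_i b i ^+ 2; set S := \sum_i a i ^+ 2.
have B0 : 0 <= B by apply: sumr_ge0 => i _; exact: sqr_ge0.
have [B_eq0|B_neq0] := eqVneq B 0.
  suff -> : C = 0 by rewrite expr0n/= B_eq0 mulr0.
  rewrite /C big1// => i _; suff -> : b i = 0 by rewrite mulr0.
  apply/eqP; rewrite -sqrf_eq0; apply/eqP.
  by move: i isT; apply: psumr_eq0P => // i _; exact: sqr_ge0.
(* Up to the factor [B], this is the part of [a] orthogonal to [b]. *)
have : 0 <= \sum_i (B * a i - C * b i) ^+ 2 by apply: sumr_ge0 => *; exact: sqr_ge0.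
have -> : \sum_i (B * a i - C * b i) ^+ 2 = B * (S * B - C ^+ 2).
  transitivity (\sum_i (B ^+ 2 * a i ^+ 2 - 2 * B * C * (a i * b i) + C ^+ 2 * b i ^+ 2)).
    by apply: eq_bigr => i _; ring.
  by rewrite big_split/= sumrB -!mulr_sumr -/S -/B -/C; ring.
by rewrite pmulr_rge0 ?subr_ge0// lt_neqAle eq_sym B_neq0.
Qed.

Lemma quad_formE (R : realType) (n : nat) (M : 'M[R]_n) (v : 'cV[R]_n) :
  (v^T *m M *m v) 0 0 = \sum_i \sum_j M i j * (v i 0 * v j 0).
Proof.
rewrite mxE exchange_big; apply: eq_bigr => j _.
by rewrite mxE big_distrl/=; apply: eq_bigr => i _; rewrite mxE; ring.
Qed.

(** * Positive semidefinite matrices and the Schur product theorem *)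

Section Psd.
Variables (R : realType) (n : nat).
Implicit Types M X : 'M[R]_n.

Lemma psdmx_sum_ge0 M (x : 'I_n -> R) :
  psdmx M -> 0 <= \sum_i \sum_j M i j * (x i * x j).
Proof.
case=> _ /(_ (\col_i x i)); rewrite quad_formE; congr (0 <= _).
by apply: eq_bigr => i _; apply: eq_bigr => j _; rewrite !mxE.
Qed.

Lemma psdmx_sym M i j : psdmx M -> M i j = M j i.
Proof. by case=> E _; rewrite -[in LHS]E mxE. Qed.

(* The form evaluated at [v + t *: e_k]. *)
Lemma psdmx_shift_ge0 M (v : 'cV[R]_n) (k : 'I_n) (t : R) : psdmx M ->
  0 <= (v^T *m M *m v) 0 0 + 2 * t * (M *m v) k 0 + t ^+ 2 * M k k.
Proof.
move=> [Msym /(_ (v + t *: delta_mx k 0))].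
have vMk : (v^T *m M *m (delta_mx k 0 : 'cV_n)) 0 0 = (M *m v) k 0.
  by rewrite -[in RHS]Msym -colE !mxE; apply: eq_bigr => i _; rewrite !mxE mulrC.
have -> : (v + t *: delta_mx k 0)^T = v^T + t *: delta_mx 0 k.
  by apply/rowP => j; rewrite !mxE eqxx andbT.
rewrite !mulmxDl !mulmxDr -!scalemxAl -!scalemxAr.
have add00 (a b : 'M[R]_1) : (a + b) 0 0 = a 0 0 + b 0 0 by rewrite mxE.
have scale00 (c : R) (a : 'M[R]_1) : (c *: a) 0 0 = c * a 0 0 by rewrite mxE.
rewrite !(add00, scale00) vMk -colE -!rowE -row_mul.
rewrite [col _ _ _ _]mxE ![row _ _ _ _]mxE => /le_trans; apply.
by rewrite le_eqVlt; apply/orP; left; apply/eqP; ring.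
Qed.

Lemma psdmx_pair_ge0 M (j k : 'I_n) (t : R) : psdmx M ->
  0 <= M j j + 2 * t * M k j + t ^+ 2 * M k k.
Proof.
move=> /(psdmx_shift_ge0 (delta_mx j 0) k t).
by rewrite trmx_delta -rowE -!colE !mxE.
Qed.

Lemma psdmx_diag_ge0 M i : psdmx M -> 0 <= M i i.
Proof. by move=> /(psdmx_pair_ge0 i i 0); rewrite mulr0 mul0r addr0 expr0n mul0r addr0. Qed.

Lemma psdmx_entry_le M i j : psdmx M -> `|M i j| <= (M i i + M j j) / 2.
Proof.
move=> psdM; have := psdmx_pair_ge0 j i 1 psdM; have := psdmx_pair_ge0 j i (-1) psdM.
by rewrite ler_norml => *; apply/andP; split; lra.
Qed.

Lemma psdmx_row0 M k j : psdmx M -> M k k = 0 -> M k j = 0.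
Proof.
move=> psdM Mkk; apply/eqP/negPn/negP => Mkj.
(* With [M k k = 0] the form is affine in the shift; this value makes it -1. *)
have := psdmx_pair_ge0 j k (- (M j j + 1) / (2 * M k j)) psdM.
have -> : 2 * (- (M j j + 1) / (2 * M k j)) * M k j = - (M j j + 1) by field.
rewrite Mkk; lra.
Qed.

Definition schur_compl X (k : 'I_n) : 'M[R]_n :=
  \matrix_(i, j) (X i j - X i k * X j k / X k k).

(** The form of the complement at [v] is the minimum over [t] of the form of [X] at [v + t *: e_k],
    attained at [t = - (X *m v) k 0 / X k k]. *)
Lemma psdmx_schur_compl X k : psdmx X -> X k k != 0 -> psdmx (schur_compl X k).
Proof.
move=> psdX Xkk; split=> [|v].
  by apply/matrixP => i j; rewrite !mxE (psdmx_sym j i psdX) (mulrC (X j k)).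
have := psdmx_shift_ge0 v k (- (X *m v) k 0 / X k k) psdX.
suff -> : (v^T *m schur_compl X k *m v) 0 0 =
    (v^T *m X *m v) 0 0 - (X *m v) k 0 ^+ 2 / X k k.
  by move=> H; apply: le_trans H _; rewrite le_eqVlt; apply/orP; left; apply/eqP; field.
rewrite !quad_formE mxE expr2 big_distrl/= big_distrl/= -sumrB.
apply: eq_bigr => i _; rewrite big_distrr/= big_distrl/= -sumrB.
apply: eq_bigr => j _; rewrite !mxE (psdmx_sym k i psdX) (psdmx_sym k j psdX).
by ring.
Qed.

(* Cholesky elimination: splitting off the rank-one matrix of column [k] kills
   the [k]-th diagonal entry, so induct on the number of nonzero ones. *)
Lemma schur_product_sum_ge0 M X (v : 'I_n -> R) : psdmx M -> psdmx X ->
  0 <= \sum_i \sum_j M i j * X i j * (v i * v j).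
Proof.
move=> psdM; move: {2}(#|_|).+1 (ltnSn #|[set k | X k k != 0]|) => m.
elim: m X => // m IH X; rewrite ltnS => Xm psdX.
have [k|X0] := pickP [pred k | X k k != 0]; last first.
  rewrite big1// => i _; rewrite big1// => j _.
  by rewrite (psdmx_row0 j psdX) ?mulr0 ?mul0r//; apply/eqP/negbFE/X0.
rewrite /= => Xkk; have psdX' := psdmx_schur_compl psdX Xkk.
(* The rank-one part contributes the form of [M] at the vector with entries [X i k * v i], divided
   by [X k k]. *)
have -> : \sum_i \sum_j M i j * X i j * (v i * v j) =
    \sum_i \sum_j M i j * schur_compl X k i j * (v i * v j) +
    (X k k)^-1 * \sum_i \sum_j M i j * ((X i k * v i) * (X j k * v j)).
  rewrite mulr_sumr -big_split; apply: eq_bigr => i _.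
  rewrite /= mulr_sumr -big_split; apply: eq_bigr => j _ /=.
  by rewrite mxE; ring.
rewrite addr_ge0 ?mulr_ge0 ?invr_ge0 ?psdmx_diag_ge0//; last exact: psdmx_sum_ge0.
apply: IH => //; apply: leq_trans Xm; apply: proper_card; apply/properP; split.
  (* A zero diagonal entry forces a zero row, so elimination creates no new nonzero diagonal
     entry. *)
  apply/fintype.subsetP => i; rewrite !inE; apply: contraNneq => Xii.
  by rewrite mxE (psdmx_row0 k psdX Xii) Xii !mul0r subr0.
by exists k; rewrite !inE// mxE -mulrA divff// mulr1 subrr eqxx.
Qed.

Lemma schur_product M X : psdmx M -> psdmx X -> psdmx (mxhad M X).
Proof.
move=> psdM psdX; split=> [|v].
  by apply/matrixP => i j; rewrite !mxE (psdmx_sym j i psdM) (psdmx_sym j i psdX).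
rewrite quad_formE; under eq_bigr do under eq_bigr do rewrite mxE.
exact: schur_product_sum_ge0.
Qed.

End Psd.

(** * A theorem of the alternative for entrywise upper bounds on the psd cone *)

Section Alternative.
Variables (R : realType) (n : nat).
Implicit Types M X : 'M[R]_n.

Lemma psdmx0 : psdmx (0 : 'M[R]_n).
Proof. by split=> [|v]; rewrite ?trmx0// mulmx0 mul0mx mxE. Qed.

Lemma psdmxD M X : psdmx M -> psdmx X -> psdmx (M + X).
Proof.
move=> [Ms M0] [Xs X0]; split=> [|v]; first by rewrite raddfD/= Ms Xs.
by rewrite mulmxDr mulmxDl mxE addr_ge0.
Qed.

Lemma psdmxZ (c : R) M : 0 <= c -> psdmx M -> psdmx (c *: M).
Proof.
move=> c0 [Ms M0]; split=> [|v]; first by rewrite linearZ/= Ms.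
by rewrite -scalemxAr -scalemxAl mxE mulr_ge0.
Qed.

Lemma psdmx_col_mul (v : 'cV[R]_n) : psdmx (v *m v^T).
Proof.
split=> [|w]; first by rewrite trmx_mul trmxK.
rewrite mulmxA -mulmxA mxE big_ord1.
suff -> : (v^T *m w) 0 0 = (w^T *m v) 0 0 by rewrite -expr2 sqr_ge0.
by rewrite !mxE; apply: eq_bigr => i _; rewrite !mxE mulrC.
Qed.

Lemma mxvec_entry_continuous (i j : 'I_n) :
  continuous (fun v : 'rV[R]_(n * n) => vec_mx v i j).
Proof.
have -> : (fun v : 'rV[R]_(n * n) => vec_mx v i j) =
    (fun v => v 0 (mxvec_index i j)) by apply/funext => v; rewrite mxE.
exact: coord_continuous.
Qed.

Lemma closed_psdmx : closed [set v : 'rV[R]_(n * n) | psdmx (vec_mx v)]%classic.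
Proof.
have closed_pre (f : 'rV[R]_(n * n) -> R) (A : set R) :
    continuous f -> closed A -> closed (f @^-1` A)%classic.
  by move=> /continuous_closedP; exact.
have -> : [set v : 'rV[R]_(n * n) | psdmx (vec_mx v)]%classic =
    ((\bigcap_(i in setT) \bigcap_(j in setT)
       [set v : 'rV[R]_(n * n) | (vec_mx v i j - vec_mx v j i)%R = 0]) `&`
     \bigcap_(w in [set: 'cV[R]_n])
       [set v : 'rV[R]_(n * n) | (0 <= (w^T *m vec_mx v *m w) 0 0)%R])%classic.
  apply/seteqP; split=> v /=.
    move=> psdv; split=> [i _ j _ /=|w _ /=]; last by case: psdv.
    by rewrite (psdmx_sym i j psdv) subrr.
  move=> [H psdv]; split=> [|w]; last exact: psdv.
  by apply/matrixP => i j; rewrite mxE; have /= /subr0_eq -> := H i I j I.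
apply: closedI.
  apply: closed_bigI => i _; apply: closed_bigI => j _.
  apply: (closed_pre _ [set x | x = 0]%classic); last exact: closed_eq.
  by move=> v; apply: continuousB; exact: mxvec_entry_continuous.
apply: closed_bigI => w _.
apply: (closed_pre _ [set x | 0 <= x]%classic); last exact: closed_ge.
rewrite (_ : (fun v => _) = fun v : 'rV[R]_(n * n) =>
  \sum_i \sum_j vec_mx v i j * (w i 0 * w j 0)); last first.
  by apply/funext => v; rewrite quad_formE.
apply: continuous_sumr => i; apply: continuous_sumr => j v.
apply: (@continuousM R _ (fun v => vec_mx v i j) (fun=> w i 0 * w j 0)).
  exact: mxvec_entry_continuous.
exact: cst_continuous.
Qed.

Variables (e : rel 'I_n) (C : 'M[R]_n).
Hypothesis e_refl : reflexive e.
Hypothesis e_sym : symmetric e.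
Hypothesis C_sym : C^T = C.

(** The relation [e] marks the bounded positions. At a minimiser this matrix becomes the certificate
    [Z] of [psdmx_le_alternative]. *)
Definition excess M : 'M[R]_n :=
  \matrix_(i, j) if e i j then Num.max (M i j - C i j) 0 else 0.

(* [excess] is half the gradient of [penalty]. *)
Definition penalty M : R := \sum_i \sum_j excess M i j ^+ 2.

Lemma penalty_continuous : continuous (fun v : 'rV[R]_(n * n) => penalty (vec_mx v)).
Proof.
apply: continuous_sumr => i; apply: continuous_sumr => j.
have -> : (fun v : 'rV[R]_(n * n) => excess (vec_mx v) i j ^+ 2) =
    (fun v => if e i j then Num.max (vec_mx v i j - C i j) 0 ^+ 2 else 0).
  by apply/funext => v; rewrite mxE; case: ifP; rewrite ?expr0n.
case: (e i j) => v; last exact: cst_continuous.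
have c : {for v, continuous (fun v : 'rV[R]_(n * n) => Num.max (vec_mx v i j - C i j) 0)}.
  apply: continuous_max; last exact: cst_continuous.
  apply: continuousB; last exact: cst_continuous.
  exact: mxvec_entry_continuous.
exact: (continuousM c c).
Qed.

(** The psd matrices with penalty at most that of 0 form a compact set: as [e] is reflexive the
    penalty bounds the diagonal, which bounds every entry. *)
Lemma penalty_min : exists2 M, psdmx M & forall X, psdmx X -> penalty M <= penalty X.
Proof.
pose F := [set v : 'rV[R]_(n * n) | psdmx (vec_mx v) /\ penalty (vec_mx v) <= penalty 0]%classic.
have F0 : (F !=set0)%classic.
  by exists 0; rewrite /F /= linear0; split => //; exact: psdmx0.
(* A diagonal entry is at most [C k k + x] with [x] its excess, and
   [x <= 1 + x ^+ 2 <= 1 + penalty 0]. *)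
pose K := 1 + penalty 0 + \sum_i `|C i i|.
have FK v i j : F v -> `|vec_mx v i j| <= K.
  move=> [psdv pv].
  have diag k : vec_mx v k k <= K.
    have Ck : C k k <= \sum_i `|C i i|.
      rewrite (bigD1 k)//= (le_trans (ler_norm _))// lerDl.
      by apply: sumr_ge0.
    have : excess (vec_mx v) k k ^+ 2 <= penalty 0.
      apply: le_trans pv; rewrite /penalty (bigD1 k)//= (bigD1 k)//= -addrA lerDl.
      by rewrite addr_ge0//; do ?[apply: sumr_ge0 => ? _]; rewrite sqr_ge0.
    have : vec_mx v k k - C k k <= excess (vec_mx v) k k.
      by rewrite [leRHS]mxE e_refl le_max lexx.
    move: Ck; rewrite /K; set x := excess _ k k; set y := vec_mx v k k - C k k.
    have -> : vec_mx v k k = y + C k k by rewrite /y subrK.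
    have := sqr_ge0 (x - 1); nra.
  by rewrite (le_trans (psdmx_entry_le i j psdv))//; have := diag i; have := diag j; lra.
have Fc : compact F.
  apply: bounded_closed_compact.
    exists K; split=> [|M KM v /= vF]; first exact: num_real.
    rewrite [leLHS]mx_normrE; apply/bigmax_leP; split=> [|[i k] _ /=].
      rewrite ltW// (le_lt_trans _ KM)// /K -addrA addr_ge0 ?addr_ge0//.
        by do 2![apply: sumr_ge0 => ? _]; rewrite sqr_ge0.
      by apply: sumr_ge0.
    rewrite ord1; case/mxvec_indexP: k => p q.
    have -> : v 0 (mxvec_index p q) = vec_mx v p q by rewrite mxE.
    by rewrite (le_trans (FK _ _ _ vF))// ltW.
  apply: closedI; first exact: closed_psdmx.
  have /continuous_closedP := penalty_continuous.
  by move=> /(_ [set x | x <= penalty 0]%classic); apply; exact: closed_le.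
have [v /set_mem vF vmin] := EVT_min_rV F0 Fc (continuous_subspaceT penalty_continuous).
exists (vec_mx v) => [|X psdX]; first by case: vF.
have [pX|/ltW pX] := leP (penalty X) (penalty 0).
  by have := vmin (mxvec X); rewrite mxvecK inE => ->//; rewrite /F/= mxvecK.
by apply: le_trans pX; case: vF.
Qed.

(** Entrywise, with [p = max(a, 0)]: [max(a + h, 0)^2 <= p^2 + 2 p h + h^2], by the signs of [a] and
    [a + h]. *)
Lemma penalty_step M D (s : R) :
  penalty (M + s *: D) <=
  penalty M + 2 * s * (\sum_i \sum_j excess M i j * D i j)
  + s ^+ 2 * \sum_i \sum_j D i j ^+ 2.
Proof.
rewrite /penalty !mulr_sumr -!big_split/=; apply: ler_sum => i _.
rewrite !mulr_sumr -!big_split/=; apply: ler_sum => j _.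
rewrite !mxE; case: ifP => _; last first.
  by have := sqr_ge0 (s * D i j); nra.
have [a0|a0] := leP (M i j - C i j) 0; have [b0|b0] := leP (M i j + s * D i j - C i j) 0.
all: have := sqr_ge0 (s * D i j); nra.
Qed.

Lemma excess_dir_ge0 M D : (forall X, psdmx X -> penalty M <= penalty X) ->
  (forall s : R, 0 < s <= 1 -> psdmx (M + s *: D)) ->
  0 <= \sum_i \sum_j excess M i j * D i j.
Proof.
move=> Mmin Ds; set a := \sum_i _; set b := \sum_i \sum_j D i j ^+ 2.
have b0 : 0 <= b by do 2![apply: sumr_ge0 => ? _]; rewrite sqr_ge0.
rewrite leNgt; apply/negP => a0.
(* If [a < 0], this [s] lies in (0, 1] and has [s * b < - a], so the change [s * (2 * a + s * b)] is
   negative. *)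
pose s := - a / (1 + b - a).
have d0 : 0 < 1 + b - a by lra.
have s0 : 0 < s by rewrite divr_gt0// oppr_gt0.
have s1 : s <= 1 by rewrite ler_pdivrMr// mul1r; lra.
have sb : s * b < - a.
  by rewrite /s mulrAC ltr_pdivrMr// ltr_pM2l ?oppr_gt0//; lra.
have := le_trans (Mmin _ (Ds s _)) (penalty_step M D s).
rewrite s0 s1 -/a -/b => /(_ isT); nra.
Qed.

Lemma psdmx_le_alternative :
  (exists2 M, psdmx M & forall i j, e i j -> M i j <= C i j) \/
  (exists Z, [/\ psdmx Z, forall i j, 0 <= Z i j,
     forall i j, ~~ e i j -> Z i j = 0 & \sum_i \sum_j Z i j * C i j < 0]).
Proof.
have [M psdM Mmin] := penalty_min.
have [[i [j /andP[eij Mij]]]|Mle] :=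
    pselect (exists i j, e i j && (C i j < M i j)); last first.
  left; exists M => // i j eij; rewrite leNgt; apply/negP => Mij.
  by apply: Mle; exists i, j; rewrite eij.
right; exists (excess M); split.
- split=> [|v].
    apply/matrixP => p q; rewrite !mxE e_sym (psdmx_sym p q psdM).
    by rewrite -[in C q p]C_sym mxE.
  (* The directions [v *m v^T] stay in the cone, and optimality along them says that the excess
     matrix is psd. *)
  rewrite quad_formE (eq_bigr (fun i => \sum_j excess M i j * (v *m v^T) i j)).
    apply: excess_dir_ge0 => // s /andP[/ltW s0 _]; apply: psdmxD => //.
    by apply: psdmxZ => //; exact: psdmx_col_mul.
  by move=> p _; apply: eq_bigr => q _; rewrite [(v *m _) _ _]mxE big_ord1 [v^T _ _]mxE.
- by move=> p q; rewrite mxE; case: ifP; rewrite // le_max lexx orbT.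
- by move=> p q /negbTE epq; rewrite mxE epq.
(* Shrinking [M] towards 0 also stays in the cone. *)
have : 0 <= \sum_p \sum_q excess M p q * (- M) p q.
  apply: excess_dir_ge0 => // s /andP[s0 s1].
  rewrite scalerN -[X in X - _]scale1r -scalerBl; apply: psdmxZ => //.
  by rewrite subr_ge0.
(* Where the excess is nonzero, [M] equals [C] plus the excess. *)
have : \sum_p \sum_q excess M p q * (- M) p q =
    - (\sum_p \sum_q excess M p q * C p q) - penalty M.
  rewrite -sumrN -sumrB; apply: eq_bigr => p _; rewrite -sumrN -sumrB.
  apply: eq_bigr => q _; rewrite [(- M) p q]mxE ![excess _ _ _]mxE.
  by case: ifP => _; [have [] := leP (M p q - C p q) 0 => _|]; ring.
have : 0 < penalty M.
  rewrite /penalty (bigD1 i)//= (bigD1 j)//= -addrA ltr_pwDl//.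
    rewrite mxE eij; have [|_] := leP (M i j - C i j) 0; first lra.
    by rewrite exprn_gt0// subr_gt0.
  by rewrite addr_ge0//; do ?[apply: sumr_ge0 => ? _]; rewrite sqr_ge0.
lra.
Qed.

End Alternative.

(** * Duality for the vector chromatic number *)

Lemma chi_vec_ub (R : realType) (n : nat) (G : sgraph 'I_n) (Z : 'M[R]_n) :
  (0 < n)%N -> psdmx Z -> (forall i j, 0 <= Z i j) ->
  (forall i j, i != j -> ~~ G i j -> Z i j = 0) ->
  \sum_i \sum_j Z i j <= chi_vec R G * \tr Z.
Proof.
move=> n0 psdZ Z0 ZG.
have tr_ge0 : 0 <= \tr Z by apply: sumr_ge0.
(* Trace 0 cannot be rescaled to 1, but then [Z] vanishes. *)
have [tr0|trN0] := eqVneq (\tr Z) 0.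
  rewrite tr0 mulr0 big1// => i _; rewrite big1// => j _.
  by apply: psdmx_row0 => //; move: i isT; apply: psumr_eq0P.
have tr_gt0 : 0 < \tr Z by rewrite lt_neqAle eq_sym trN0.
have Zf : chi_vec_feasible G ((\tr Z)^-1 *: Z).
  split.
  - by rewrite /mxdot mul1mx mxtraceZ mulVf.
  - apply/matrixP => i j; rewrite !mxE /= /compl_adj.
    case: eqVneq => [|ij]/=; first by rewrite mulr0.
    by case: (boolP (G i j)) => Gij; rewrite ?mulr0// ZG// mulr0 mul0r.
  - by move=> i j; rewrite mxE mulr_ge0// invr_ge0.
  - by apply: psdmxZ => //; rewrite invr_ge0.
have [W [_ -> /(_ _ Zf)]] := @chi_vec_max R n G n0.
rewrite [leLHS]mxdot_sum -ler_pdivrMr//; apply: le_trans.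
rewrite exchange_big mulrC mulr_sumr; apply: ler_sum => i _.
by rewrite mulr_sumr; apply: ler_sum => j _; rewrite !mxE mul1r.
Qed.

(* Strong duality: [M] is the Gram matrix of an optimal vector colouring. *)
Lemma chi_vec_dual (R : realType) (n : nat) (G : sgraph 'I_n) : (0 < n)%N ->
  exists M : 'M[R]_n, [/\ psdmx M, forall i, M i i <= chi_vec R G - 1 &
    forall i j, G i j -> M i j <= -1].
Proof.
move=> n0; set t := chi_vec R G.
pose e : rel 'I_n := fun i j => (i == j) || G i j.
pose C : 'M[R]_n := \matrix_(i, j) if i == j then t - 1 else -1.
have e_refl : reflexive e by move=> i; rewrite /e eqxx.
have e_sym : symmetric e by move=> i j; rewrite /e eq_sym adj_sym.
have C_sym : C^T = C by apply/matrixP => i j; rewrite !mxE eq_sym.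
have [[M psdM Me]|[Z [psdZ Z0 Ze]]] := psdmx_le_alternative e_refl e_sym C_sym.
  exists M; split=> // [i|i j Gij].
    by have := Me i i (e_refl i); rewrite mxE eqxx.
  have := Me i j; rewrite /e Gij orbT mxE => /(_ isT).
  by case: eqVneq => // ij; rewrite ij adj_irrefl in Gij.
have : \sum_i \sum_j Z i j <= t * \tr Z.
  by apply: chi_vec_ub => // i j ij Gij; apply: Ze; rewrite /e negb_or ij.
(* The negative value of the certificate would contradict the bound just obtained. *)
suff -> : \sum_i \sum_j Z i j * C i j = t * \tr Z - \sum_i \sum_j Z i j by lra.
rewrite mulr_sumr -sumrB; apply: eq_bigr => i _.
rewrite (bigD1 i)//= [in RHS](bigD1 i)//= mxE eqxx.
rewrite (eq_bigr (fun j => - Z i j)).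
  by rewrite sumrN; ring.
by move=> j ji; rewrite mxE eq_sym (negbTE ji) mulrN1.
Qed.

(** * From the dual matrix to the inequality *)

Lemma sum_adj_le (R : realType) (n : nat) (G : sgraph 'I_n) (W : 'M[R]_n) :
  (forall M, psdmx M -> 0 <= \sum_i \sum_j M i j * W i j) ->
  (forall i j, 0 <= W i j) ->
  \sum_i \sum_j (G i j)%:R * W i j <=
  (1 - 1 / chi_vec R G) * \sum_i \sum_j W i j.
Proof.
move=> dualW W0; case: n => [|n] in G W dualW W0 *; first by rewrite !big_ord0 mulr0.
have [M [psdM Md MG]] := chi_vec_dual R G (ltn0Sn n); set t := chi_vec R G in Md *.
have t1 : 1 <= t by have := psdmx_diag_ge0 0 psdM; have := Md 0; lra.
have Mle i j : M i j <= t - 1.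
  apply: le_trans (ler_norm _) _; apply: le_trans (psdmx_entry_le i j psdM) _.
  by have := Md i; have := Md j; lra.
(* Entrywise [M <= (t - 1) J - t A], on edges because [M i j <= -1]; pair this with the nonnegative
   [W]. *)
have H : 0 <= (t - 1) * (\sum_i \sum_j W i j) - t * \sum_i \sum_j (G i j)%:R * W i j.
  apply: le_trans (dualW M psdM) _; rewrite !mulr_sumr -sumrB; apply: ler_sum => i _.
  rewrite !mulr_sumr -sumrB; apply: ler_sum => j _.
  rewrite mulrA -mulrBl ler_wpM2r//.
  by case: (boolP (G i j)) => [/MG|_]; [rewrite mulr1; lra|rewrite mulr0 subr0].
have t0 : 0 < t by lra.
have -> : 1 - 1 / t = (t - 1) / t by field; rewrite gt_eqF.
by rewrite mulrAC ler_pdivlMr// mulrC -subr_ge0.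
Qed.

Theorem lemma2 (R : realType) (n : nat) (X Y A : 'M[R]_n) (G : sgraph 'I_n)
    (X_psd : psdmx X)
    (Y_sym : Y^T = Y)
    (Y_diag0 : forall i : 'I_n, Y i i = 0)
    (A_supp : forall i j : 'I_n,
      A i j = if mxhad X Y i j != 0 then 1 else 0)
    (G_adj : adjmx R G = A) :
  mxdot X Y ^+ 2 <= (1 - 1 / chi_vec R G) * mxdot X X * mxdot Y Y.
Proof.
have W_le : \sum_i \sum_j (G i j)%:R * mxhad X X i j <=
    (1 - 1 / chi_vec R G) * mxdot X X.
  have -> : mxdot X X = \sum_i \sum_j mxhad X X i j.
    rewrite mxdot_sum; apply: eq_bigr => i _; apply: eq_bigr => j _.
    by rewrite mxE (psdmx_sym j i X_psd).
  apply: sum_adj_le => [M psdM|i j]; last by rewrite mxE -expr2 sqr_ge0.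
  (* The pairing of [M] with [X o X] is the form of their entrywise product at the all-ones
     vector. *)
  have := psdmx_sum_ge0 (fun=> 1) (schur_product psdM (schur_product X_psd X_psd)).
  congr (0 <= _); apply: eq_bigr => i _; apply: eq_bigr => j _.
  by rewrite mxE !mulr1.
have YY : mxdot Y Y = \sum_p Y p.1 p.2 ^+ 2.
  rewrite mxdot_sum pair_big; apply: eq_bigr => -[i j] _ /=.
  by rewrite -[in Y j i]Y_sym mxE.
(* Off the edges [X i j * Y i j] is 0, so [X] may be masked by the adjacency matrix. *)
have XY : mxdot X Y = \sum_p ((G p.1 p.2)%:R * X p.1 p.2) * Y p.1 p.2.
  rewrite mxdot_sum pair_big; apply: eq_bigr => -[i j] _ /=.
  have := A_supp i j; rewrite -G_adj !mxE -[in Y j i]Y_sym mxE.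
  by case: eqVneq => [XY0 ->|_ ->]; rewrite ?mul1r// XY0 !mul0r.
apply: (@le_trans _ _ ((\sum_i \sum_j (G i j)%:R * mxhad X X i j) * mxdot Y Y)).
  rewrite XY YY; apply: le_trans (sum_cauchy_schwarz _ _) _.
  rewrite le_eqVlt; apply/orP; left; apply/eqP; congr (_ * _).
  rewrite pair_big; apply: eq_bigr => -[i j] _ /=.
  (* The 0/1 mask equals its own square. *)
  by rewrite mxE exprMn -expr2; case: (G i j); rewrite ?expr1n ?expr0n ?mul0r.
rewrite ler_wpM2r// YY; apply: sumr_ge0 => p _; exact: sqr_ge0.
Qed.
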